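(* Consider an alternating-current circuit with $n=|N|$ buses and a single slack bus, the reference bus $0\in N$ (i.e. $G=\{0\}$). Then, for all parameters $(Y,|v_0|,(p_k)_{k\in N\setminus\{0\}},(q_k)_{k\in N\setminus\{0\}})$ outside a set of measure zero in the parameter space, the alternating-current power flow system in the unknowns $(v,u)\in\mathbb{C}^{N}\times\mathbb{C}^{N}$, $$v_k\sum_{l\in N} Y_{k,l}u_l + u_k\sum_{l\in N} Y_{k,l}^*v_l = 2p_k,\qquad k\in N\setminus\{0\},$$ $$v_k\sum_{l\in N} Y_{k,l}u_l - u_k\sum_{l\in N} Y_{k,l}^*v_l = 2\mathrm{i}\,q_k,\qquad k\in N\setminus\{0\},$$ $$v_0=|v_0|,\qquad u_0=|v_0|,$$ has a finite number of complex solutions, and this number is bounded above by $$\binom{2n-2}{n-1}.$$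
   Context: A circuit is given by a finite undirected graph $(N,E)$ whose vertices are called buses and whose edges are called branches, with a distinguished reference (slack) bus $0\in N$, and an admittance matrix $Y\in\mathbb{C}^{N\times N}$ with $Y_{k,l}=0$ whenever $k\neq l$ and $\{k,l\}\notin E$. No losslessness assumption is made: entries of $Y$ may have nonzero real and imaginary parts. $z^*$ denotes the complex conjugate and $\mathrm{i}$ the imaginary unit. At the reference bus the voltage is fixed, with phase $0$ and magnitude $|v_0|>0$ (a given real number). At every other bus $k$ the real numbers $p_k$ (active power) and $q_k$ (reactive power) are given. The variable $v_k$ is the complex voltage at bus $k$, and $u_k$ is an independent complex variable replacing $v_k^*$. A complex solution is any $(v,u)$ satisfying the system; it is not required that $u=v^*$. For a fixed graph, the parameter space is the set of all tuples $(Y,|v_0|,p,q)$ where $Y\in\mathbb{C}^{N\times N}$ satisfies $Y_{k,l}=0$ whenever $k\neq l$ and $\{k,l\}\notin E$, $|v_0|>0$ is a real number, $p=(p_k)_{k\in N\setminus\{0\}}\in\mathbb{R}^{N\setminus\{0\}}$ and $q=(q_k)_{k\in N\setminus\{0\}}\in\mathbb{R}^{N\setminus\{0\}}$, with Lebesgue measure (viewed as an open subset of a finite-dimensional real vector space). *)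

(* Defs.v *)
From HB Require Import structures.
From mathcomp Require Import all_boot all_order all_algebra.
From mathcomp Require Import all_classical all_reals all_analysis.
From mathcomp Require Import complex.

Set Implicit Arguments.
Unset Strict Implicit.
Unset Printing Implicit Defensive.
Import Order.TTheory GRing.Theory Num.Theory.
Local Open Scope classical_set_scope.
Local Open Scope ring_scope.
Local Open Scope complex_scope.

(* MathComp-Analysis has no Lebesgue measure on R^I for a finite type I, so
   nullity is defined directly as vanishing of the Lebesgue outer measure: for
   every eps > 0, a countable cover by boxes of total volume below eps. *)
Definition lebesgue_null (R : realType) (I : finType) (A : set (I -> R)) :=
  forall eps : R, 0 < eps ->
    exists a b : nat -> I -> R,
      [/\ forall j i, a j i <= b j i,
          A `<=` \bigcup_j [set x | forall i, a j i <= x i <= b j i] &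
          (\sum_(0 <= j <oo) (\prod_(i : I) (b j i - a j i))%:E < eps%:E)%E].

Section PowerFlow.
Variables (R : realType) (N : finType) (E : rel N) (ref : N).

Record parameters := MkParameters {
  admittance : N -> N -> R[i];
  admittance_sparse :
    forall k l, k != l -> ~~ E k l -> admittance k l = 0;
  ref_magnitude : R;
  ref_magnitude_gt0 : 0 < ref_magnitude;
  active_power : {k : N | k != ref} -> R;
  reactive_power : {k : N | k != ref} -> R }.

(* The real coordinates of the ambient vector space of the parameters: real
   (true) and imaginary (false) parts of the entries of Y not forced to vanish,
   then |v_0|, the p_k and the q_k. *)
Definition coordinate : finType :=
  (({kl : N * N | (kl.1 == kl.2) || E kl.1 kl.2} * bool)
   + unit + {k : N | k != ref} + {k : N | k != ref})%type.

Definition coordinates (P : parameters) (c : coordinate) : R :=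
  match c with
  | inl (inl (inl (kl, true))) =>
      complex.Re (admittance P (val kl).1 (val kl).2)
  | inl (inl (inl (kl, false))) =>
      complex.Im (admittance P (val kl).1 (val kl).2)
  | inl (inl (inr tt)) => ref_magnitude P
  | inl (inr k) => active_power P k
  | inr k => reactive_power P k
  end.

Definition parameters_null (Z : set parameters) :=
  lebesgue_null (coordinates @` Z).

Definition power_flow_solutions (P : parameters) :
    set ({ffun N -> R[i]} * {ffun N -> R[i]}) :=
  [set vu : {ffun N -> R[i]} * {ffun N -> R[i]} |
    let v := vu.1 in let u := vu.2 in let Y := admittance P in
    [/\ forall k : {k : N | k != ref},
          v (val k) * (\sum_(l : N) Y (val k) l * u l)
          + u (val k) * (\sum_(l : N) (Y (val k) l)^*%C * v l)
          = 2 * (active_power P k)%:C,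
        forall k : {k : N | k != ref},
          v (val k) * (\sum_(l : N) Y (val k) l * u l)
          - u (val k) * (\sum_(l : N) (Y (val k) l)^*%C * v l)
          = 2 * 'i%C * (reactive_power P k)%:C,
        v ref = (ref_magnitude P)%:C &
        u ref = (ref_magnitude P)%:C]].

End PowerFlow.

(* Main.v *)
(* Let K be the set of non-reference buses, m = #|K| and D = C(2m, m). Adding
   and subtracting the equations, p and q become polynomials P, Q of degree at
   most 1 in v and at most 1 in u, with coefficients depending on the circuit
   parameters y = (Y, |v_0|). For a linear form g in (v, u), the products
   y^beta (P, Q)^alpha g^j with |alpha| <= t and j <= D have degree at most t + D
   in v and in u; for large t and many beta they outnumber the monomials of that
   multidegree, because C(2m+t, 2m) (D+1) > C(m+t+D, m)^2. Hence they are linearly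
   dependent, that is, \sum_(j <= D) A_j(y, P, Q) g^j = 0 identically for
   polynomials A_j that are not all zero. Wherever A_j(y, p, q) <> 0 for some j,
   g takes at most D values on the solutions. This excludes a null set for each of
   countably many forms g, and any D+1 distinct solutions are separated by one of
   them. The zero set of a nonzero polynomial f is null, by induction on the
   degree: it is contained in {f = 0, d_i f <> 0}, a countable union of Lipschitz
   graphs, together with the zero set of a nonzero d_i f. *)
Require Import Defs.
From mathcomp Require Import all_boot all_order all_algebra finmap.
From mathcomp Require Import all_classical all_reals all_analysis.
From mathcomp Require Import complex ring lra zify.

Set Implicit Arguments.
Unset Strict Implicit.
Unset Printing Implicit Defensive.
Import Order.TTheory GRing.Theory Num.Theory.
Local Open Scope classical_set_scope.
Local Open Scope ring_scope.
Local Open Scope complex_scope.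

(** * Lebesgue null sets *)

Section Null.
Variables (R : realType) (I : finType).
Implicit Types (A B : set (I -> R)) (x y : I -> R).

Lemma lebesgue_null_sub A B : A `<=` B -> lebesgue_null B -> lebesgue_null A.
Proof.
move=> AB nB e /nB [a [b [ab Bab lt]]]; exists a, b; split=> //.
exact: subset_trans Bab.
Qed.

Lemma lebesgue_null_bigcup_nat (F : nat -> set (I -> R)) :
  (forall n, lebesgue_null (F n)) -> lebesgue_null (\bigcup_n F n).
Proof.
move=> nF e e0.
(* These volumes sum to [e / 2] rather than [e]: the summation keeps only non-strict bounds, while
   nullity asks for a strict one. *)
have dn n : 0 < e / 2 / (2 ^ n.+1)%:R :> R.
  by rewrite !divr_gt0 ?ltr0n ?expn_gt0.
have /choice[ab abP] n : exists ab : (nat -> I -> R) * (nat -> I -> R),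
  [/\ forall j i, ab.1 j i <= ab.2 j i,
      F n `<=` \bigcup_j [set x | forall i, ab.1 j i <= x i <= ab.2 j i] &
      (\sum_(0 <= j <oo) (\prod_(i : I) (ab.2 j i - ab.1 j i))%:E
         < (e / 2 / (2 ^ n.+1)%:R)%:E)%E].
  by have [a [b]] := nF n _ (dn n); exists (a, b).
have /card_set_bijP [f fbij] : ([set: nat] #= [set: nat * nat])%card.
  by rewrite card_eq_sym card_nat2.
have vol0 n j : (0 <= (\prod_(i : I) ((ab n).2 j i - (ab n).1 j i))%:E)%E.
  rewrite lee_fin prodr_ge0 // => i _; rewrite subr_ge0.
  by case: (abP n) => + _ _; apply.
exists (fun k => (ab (f k).1).1 (f k).2), (fun k => (ab (f k).1).2 (f k).2).
split.
- by move=> k i; case: (abP (f k).1) => + _ _; apply.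
- move=> x [n _ Fnx]; case: (abP n) => _ /(_ _ Fnx) [j _ xj] _.
  have [_ _ /(_ (n, j) Logic.I)[k _ fk]] := fbij.
  by exists k => //=; rewrite fk.
- rewrite nneseries_esumT //.
  pose g (p : nat * nat) : \bar R :=
    (\prod_(i : I) ((ab p.1).2 p.2 i - (ab p.1).1 p.2 i))%:E.
  rewrite -(@reindex_esum _ _ _ setT setT f g) //.
  rewrite (_ : setT = setT `*`` (fun=> setT)); last by apply/seteqP.
  rewrite -(@esum_esum _ _ _ setT (fun=> setT) (fun i j => g (i, j))) //; last first.
    by move=> i j _ _; exact: vol0.
  apply: (@le_lt_trans _ _ (e / 2)%:E); last by rewrite lte_fin; lra.
  apply: le_trans (epsilon_trick0 xpredT (ltW _)); last by lra.
  rewrite nneseries_esumT; last by move=> n; rewrite lee_fin ltW.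
  apply: le_esum => n _; rewrite -nneseries_esumT; last by move=> j; exact: vol0.
  by case: (abP n) => _ _ /ltW.
Qed.

(* The index i0 is needed: if I is empty every box has volume 1, the empty
   product, and then even set0 is not null. *)
Lemma lebesgue_null0 (i0 : I) : lebesgue_null (@set0 (I -> R)).
Proof.
move=> e e0; exists (fun _ _ => 0), (fun _ _ => 0); split=> //.
rewrite eseries0 // => j _ _.
by rewrite (bigD1 i0) //= subrr mul0r.
Qed.

Lemma lebesgue_null_bigcup (i0 : I) (T : countType) (F : T -> set (I -> R)) :
  (forall t, lebesgue_null (F t)) -> lebesgue_null (\bigcup_t F t).
Proof.
move=> nF; pose G n := if choice.unpickle n is Some t then F t else set0.
apply: (@lebesgue_null_sub _ (\bigcup_n G n)).
  by move=> x [t _ Ft]; exists (choice.pickle t) => //; rewrite /G choice.pickleK.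
apply: lebesgue_null_bigcup_nat => n; rewrite /G.
by case: (choice.unpickle n) => [t|]; [exact: nF | exact: lebesgue_null0].
Qed.

Lemma lebesgue_null_setU (i0 : I) A B :
  lebesgue_null A -> lebesgue_null B -> lebesgue_null (A `|` B).
Proof.
move=> nA nB.
apply: (@lebesgue_null_sub _ (\bigcup_b if b then A else B)).
  by move=> x [Ax|Bx]; [exists true | exists false].
by apply: lebesgue_null_bigcup => // -[].
Qed.

Lemma lebesgue_null_finite_cover (i0 : I) A :
  (forall e : R, 0 < e -> exists (T : finType) (a b : T -> I -> R),
    [/\ forall t i, a t i <= b t i,
        forall x, A x -> exists t, forall i, a t i <= x i <= b t i &
        \sum_t \prod_i (b t i - a t i) < e]) ->
  lebesgue_null A.
Proof.
move=> cA e /cA[T [a [b [ab Aab lt]]]].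
(* Past the first [#|T|] boxes the sequence continues with the degenerate box at 0, of volume 0
   because its side along [i0] vanishes. *)
pose ext (f : T -> I -> R) n :=
  if insub n : option 'I_#|T| is Some k then f (enum_val k) else fun=> 0.
have ext_val f (k : 'I_#|T|) : ext f k = f (enum_val k) by rewrite /ext valK.
exists (ext a), (ext b); split.
- by move=> n i; rewrite /ext; case: insub.
- move=> x /Aab[t xt]; exists (enum_rank t) => //= i.
  by rewrite !ext_val enum_rankK.
have ext0 n : 0 <= \prod_(i : I) (ext b n i - ext a n i).
  rewrite prodr_ge0 // => i _; rewrite subr_ge0 /ext.
  by case: insub.
rewrite (nneseries_split _ #|T|); last by move=> n _; rewrite lee_fin.
rewrite eseries0 ?adde0; last first.
  move=> n; rewrite add0n => Tn _.
  by rewrite /ext insubN -?leqNgt // (bigD1 i0) //= subrr mul0r.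
rewrite add0n big_mkord sumEFin lte_fin; apply: le_lt_trans lt.
rewrite [leRHS](reindex (@enum_val T predT)) /=; last first.
  by apply: onW_bij; exact: enum_val_bij.
by apply: ler_sum => k _; under eq_bigr do rewrite !ext_val.
Qed.

(** A grid of mesh of order [1/K] on the coordinates other than [i0] has [K ^ n] cells. Over each
    cell the Lipschitz bound confines [A] to a box whose side along [i0] is again of order [1/K], so
    the total volume is of order [1/K]. *)
Lemma lebesgue_null_lipschitz_graph (i0 : I) (M C : R) A :
  (forall x i, A x -> - M <= x i < M) ->
  (forall x y (d : R), 0 <= d -> A x -> A y ->
     (forall j, j != i0 -> `|x j - y j| <= d) ->
     `|x i0 - y i0| <= C * d) ->
  lebesgue_null A.
Proof.
move=> AM AC.
have [->|/set0P[x0 Ax0]] := eqVneq A set0; first exact: lebesgue_null0.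
have M0 : 0 < M by case/andP: (AM _ i0 Ax0) => h1 h2; lra.
have C0 : 0 <= C.
  rewrite -[C]mulr1; apply: le_trans (AC x0 x0 1 ler01 Ax0 Ax0 _) => // j _.
  by rewrite subrr normr0 ler01.
apply: (lebesgue_null_finite_cover i0) => e e0.
pose n := #|{: {j | j != i0}}|.
(* The left side, divided by [K], is the total volume of the boxes built below. *)
have [K K0 Klt] : exists2 K : nat, (0 < K)%N & (4 * M) ^+ n * (4 * C * M) < e * K%:R.
  exists (Num.truncn ((4 * M) ^+ n * (4 * C * M) / e)).+1 => //.
  by rewrite [ltRHS]mulrC -ltr_pdivrMr // truncnS_gt.
have KR0 : 0 < K%:R :> R by rewrite ltr0n.
have [h h0 hK] : exists2 h : R, 0 < h & h * K%:R = 2 * M.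
  by exists (2 * M / K%:R); rewrite ?mulfVK ?gt_eqF // divr_gt0 // mulr_gt0.
pose cell x (j : I) := Num.truncn ((x j + M) / h).
have cellK x j : A x -> (cell x j < K)%N.
  move=> /(AM _ j) /andP[l u]; rewrite truncn_lt_nat; last first.
    by rewrite divr_ge0 ?(ltW h0) //; lra.
  by rewrite ltr_pdivrMr // mulrC hK; lra.
pose kap x : {ffun {j | j != i0} -> 'I_K} :=
  [ffun j => insubd (Ordinal K0) (cell x (val j))].
have kap_close x y j : A x -> A y -> kap x = kap y -> j != i0 -> `|x j - y j| <= h.
  move=> Ax Ay /ffunP xy ji.
  have := xy (Sub j ji); rewrite !ffunE => /(congr1 val).
  rewrite !val_insubd !cellK // /cell /= => eqt.
  have ge0 z : A z -> 0 <= (z j + M) / h.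
    by move=> /(AM _ j) /andP[l u]; rewrite divr_ge0 ?(ltW h0) //; lra.
  have /andP[] := truncn_itv (ge0 _ Ax).
  have /andP[] := truncn_itv (ge0 _ Ay).
  rewrite -eqt; set t := Num.truncn _; rewrite -natr1.
  rewrite !ler_pdivlMr // !ltr_pdivrMr // mulrDl mul1r => l1 l2 l3 l4.
  by rewrite ler_norml; lra.
(* [z k] is a point of [A] in the cell [k] and serves as the centre of its box; a cell that [A]
   misses gets the default 0. *)
have /choice[z zP] (k : {ffun {j | j != i0} -> 'I_K}) : exists z : I -> R,
    forall x, A x -> kap x = k -> A z /\ kap z = k.
  have [[x [Ax <-]]|nx] := pselect (exists x, A x /\ kap x = k); first by exists x.
  by exists (fun=> 0) => x Ax kx; case: nx; exists x.
pose w j := if j == i0 then C * h else h.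
have w0 j : 0 <= w j by rewrite /w; case: ifP => _; rewrite ?mulr_ge0 // ltW.
exists {ffun {j | j != i0} -> 'I_K}, (fun k j => z k j - w j), (fun k j => z k j + w j).
split.
- by move=> k j; have := w0 j; lra.
- move=> x Ax; exists (kap x) => j.
  have [Az kz] := zP _ _ Ax erefl.
  suff : `|x j - z (kap x) j| <= w j by rewrite ler_norml; lra.
  rewrite /w; case: eqVneq => [->|ji]; last exact: kap_close.
  by apply: AC => // [|j' ji']; [exact: ltW | exact: kap_close].
- rewrite (eq_bigr (fun=> \prod_j (2 * w j))); last first.
    by move=> k _; apply: eq_bigr => j _; ring.
  rewrite sumr_const card_ffun card_ord (bigD1 i0) //= /w eqxx.
  rewrite (eq_bigr (fun=> 2 * h)); last by move=> j /negbTE ->.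
  rewrite prodr_const.
  have -> : #|[pred j | j != i0]| = n by rewrite /n card_sig.
  rewrite -[ltLHS]mulr_natr -[#|{: _}|]/n natrX.
  have -> : 2 * (C * h) * (2 * h) ^+ n * K%:R ^+ n
         = (4 * M) ^+ n * (4 * C * M) / K%:R.
    rewrite -[LHS]mulrA -exprMn -[2 * h * _]mulrA hK.
    rewrite (_ : 2 * (2 * M) = 4 * M); last by ring.
    have -> : h = 2 * M / K%:R by rewrite -hK mulfK // gt_eqF.
    by ring.
  by rewrite ltr_pdivrMr.
Qed.
End Null.

(** * Zero sets of polynomials *)

Definition monomial (F : comNzRingType) (I : finType) (e : I -> nat)
    (x : I -> F) : F :=
  \prod_i x i ^+ e i.

Section PartialDerivative.
Variables (R : realType) (I : finType) (i0 : I).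
Implicit Types (g h : (I -> R) -> R) (x y : I -> R).

(* The error is quadratic in the direction i0 but may be linear in the others.
   This is enough for the zeros of g at which h is bounded below to be locally a
   Lipschitz graph over the other coordinates. *)
Definition is_partial g h := forall M : R, 0 <= M -> exists2 B : R, 0 <= B &
  forall x, (forall i, `|x i| <= M) ->
    [/\ `|g x| <= B, `|h x| <= B &
      forall y (d : R), 0 <= d -> (forall i, `|y i| <= M) ->
      (forall j, j != i0 -> `|y j - x j| <= d) ->
      `|g y - g x - h x * (y i0 - x i0)| <= B * ((y i0 - x i0) ^+ 2 + d)].

Lemma is_partial_cst c : is_partial (fun=> c) (fun=> 0).
Proof.
move=> M M0; exists `|c| => // x xM; split; rewrite ?normr0 // => y d d0 yM _.
by rewrite subrr mul0r subrr normr0 mulr_ge0 // addr_ge0 // sqr_ge0.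
Qed.

Lemma is_partial_coord j : is_partial (fun x => x j) (fun=> (j == i0)%:R).
Proof.
move=> M M0; exists (M + 1) => [|x xM]; first by lra.
split; first by have := xM j; lra.
  by case: eqP => _; rewrite ?normr1 ?normr0; lra.
move=> y d d0 yM yx; have s0 := sqr_ge0 (y i0 - x i0).
case: eqVneq => [->|ji0].
  by rewrite mul1r subrr normr0 mulr_ge0 ?addr_ge0 // ler01.
by rewrite mul0r subr0; have := yx _ ji0; nra.
Qed.

Lemma is_partialD g1 h1 g2 h2 : is_partial g1 h1 -> is_partial g2 h2 ->
  is_partial (fun x => g1 x + g2 x) (fun x => h1 x + h2 x).
Proof.
move=> p1 p2 M M0; have [B1 B10 {}p1] := p1 M M0; have [B2 B20 {}p2] := p2 M M0.
exists (B1 + B2) => [|x xM]; first exact: addr_ge0.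
have [a1 b1 {}p1] := p1 x xM; have [a2 b2 {}p2] := p2 x xM.
split; [by apply: le_trans (ler_normD _ _) _; exact: lerD..|].
move=> y d d0 yM yx; have {}p1 := p1 y d d0 yM yx; have {}p2 := p2 y d d0 yM yx.
rewrite (_ : _ - _ = (g1 y - g1 x - h1 x * (y i0 - x i0)) +
  (g2 y - g2 x - h2 x * (y i0 - x i0))); last by ring.
by apply: le_trans (ler_normD _ _) _; rewrite mulrDl lerD.
Qed.

Lemma is_partialM g1 h1 g2 h2 : is_partial g1 h1 -> is_partial g2 h2 ->
  is_partial (fun x => g1 x * g2 x) (fun x => h1 x * g2 x + g1 x * h2 x).
Proof.
move=> p1 p2 M M0; have [B1 B10 {}p1] := p1 M M0; have [B2 B20 {}p2] := p2 M M0.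
pose B := B1 * B2.
have B0 : 0 <= B by exact: mulr_ge0.
exists ((3 + 2 * M) * B) => [|x xM]; first by rewrite mulr_ge0 //; lra.
have [a1 b1 {}p1] := p1 x xM; have [a2 b2 q2] := p2 x xM.
have MB : 0 <= M * B by exact: mulr_ge0.
split.
- by rewrite normrM; apply: le_trans (ler_pM _ _ a1 a2) _ => //; rewrite -/B; lra.
- apply: le_trans (ler_normD _ _) _; rewrite !normrM.
  apply: le_trans (lerD (ler_pM _ _ b1 a2) (ler_pM _ _ a1 b2)) _ => //.
  by rewrite -/B; lra.
move=> y d d0 yM yx.
have [a2y _ _] := p2 y yM.
have {}p1 := p1 y d d0 yM yx; have {}q2 := q2 y d d0 yM yx.
set D := y i0 - x i0 in p1 q2 *.
set S := D ^+ 2 + d in p1 q2 *.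
have S0 : 0 <= S by rewrite addr_ge0 // sqr_ge0.
have DM : `|D| <= 2 * M.
  by apply: le_trans (ler_normB _ _) _; have := xM i0; have := yM i0; lra.
(* The four terms are bounded by [B * S], [B * S], [2 * M * B * S] and [B * S], which explains the
   constant [3 + 2 * M]. *)
rewrite (_ : _ - _ = (g1 y - g1 x - h1 x * D) * g2 y + h1 x * (h2 x * D ^+ 2)
  + h1 x * (D * (g2 y - g2 x - h2 x * D)) +
  g1 x * (g2 y - g2 x - h2 x * D)); last by ring.
have D2 : `|D ^+ 2| <= S by rewrite ger0_norm ?sqr_ge0 // lerDl.
have lerDn (u v s t : R) : `|u| <= s -> `|v| <= t -> `|u + v| <= s + t.
  by move=> us vt; apply: le_trans (ler_normD _ _) _; exact: lerD.
have lerMn (u v s t : R) : `|u| <= s -> `|v| <= t -> `|u * v| <= s * t.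
  by move=> us vt; rewrite normrM ler_pM.
rewrite (_ : _ * S = (B1 * S) * B2 + B1 * (B2 * S) + B1 * ((2 * M) * (B2 * S))
   + B1 * (B2 * S)); last by rewrite /B; ring.
by do ![apply/lerDn | apply/lerMn => //].
Qed.

Lemma is_partialX g h n : is_partial g h ->
  is_partial (fun x => g x ^+ n) (fun x => h x *+ n * g x ^+ n.-1).
Proof.
move=> p; elim: n => [|n IH].
  by have := is_partial_cst 1; congr is_partial; apply: funext => x; rewrite mul0r.
have := is_partialM p IH.
congr is_partial; apply: funext => x /=; rewrite ?exprS //.
by case: n {IH} => [|n] /=; [ring | rewrite exprS mulrS; ring].
Qed.

(** If [e i0] is 0, the truncated subtraction leaves the exponent alone and the factor [(e i0)%:R]
    still makes the derivative 0. *)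
Lemma is_partial_monomial e :
  is_partial (monomial e)
    (fun x => (e i0)%:R * monomial (fun j => (e j - (j == i0))%N) x).
Proof.
have p0 (s : seq I) :
    is_partial (fun x => \prod_(j <- s | j != i0) x j ^+ e j) (fun=> 0).
  elim: s => [|j s IH].
    by have := is_partial_cst 1; congr is_partial; apply: funext => x; rewrite big_nil.
  have [->|ji] := eqVneq j i0.
    by move: IH; congr is_partial; apply: funext => x; rewrite big_cons eqxx.
  have := is_partialM (is_partialX (e j) (is_partial_coord j)) IH.
  congr is_partial; apply: funext => x; first by rewrite big_cons ji.
  by rewrite (negbTE ji) mul0rn !mul0r mulr0 addr0.
have := is_partialM (is_partialX (e i0) (is_partial_coord i0)) (p0 (index_enum I)).
congr is_partial; apply: funext => x; rewrite /monomial.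
  by rewrite [RHS](bigD1 i0).
rewrite [in RHS](bigD1 i0) //= eqxx subn1 mulr0 addr0 mulrA; congr (_ * _).
by apply: eq_bigr => j /negbTE ->; rewrite subn0.
Qed.

Lemma is_partial_sum (T : finType) (g h : T -> (I -> R) -> R) (c : T -> R) :
  (forall t, is_partial (g t) (h t)) ->
  is_partial (fun x => \sum_t c t * g t x) (fun x => \sum_t c t * h t x).
Proof.
move=> p; elim: (index_enum T) => [|t s IH].
  by have := is_partial_cst 0; congr is_partial; apply: funext => x; rewrite big_nil.
have := is_partialD (is_partialM (is_partial_cst (c t)) (p t)) IH.
by congr is_partial; apply: funext => x; rewrite big_cons ?mul0r ?add0r.
Qed.

(** The set is cut into pieces [E k] where [x] is bounded and [h] is bounded away from 0, and these
    into cubes of side [d]. For two zeros in one cube, at distance [D] along [i0], the quadratic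
    error is at most half of the norm of [D] by the choice of [d]; absorbing it leaves a Lipschitz
    bound with constant [2 * k.+1%:R * B]. *)
Lemma lebesgue_null_regular_zeros g h : is_partial g h ->
  lebesgue_null [set x | g x = 0 /\ h x != 0].
Proof.
move=> p.
pose E (k : nat) := [set x : I -> R | [/\ forall i, `|x i| <= k%:R, g x = 0 &
   k.+1%:R^-1 <= `|h x|]].
suff nE k : lebesgue_null (E k).
  apply: lebesgue_null_sub (lebesgue_null_bigcup i0 nE) => x [gx hx].
  pose s := `|h x|^-1 + \sum_i `|x i|; exists (Num.truncn s).+1 => //.
  have lt_s : s < (Num.truncn s).+1%:R by exact: truncnS_gt.
  have ih0 : 0 <= `|h x|^-1 by rewrite invr_ge0.
  split=> //.
    move=> i; apply/ltW/(le_lt_trans _ lt_s).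
    rewrite /s (bigD1 i) //= addrCA lerDl addr_ge0 // sumr_ge0 //.
  rewrite -[leRHS]invrK lef_pV2 ?posrE ?invr_gt0 ?normr_gt0 ?ltr0n //.
  rewrite -natr1; apply/ltW; apply: le_lt_trans (lt_le_trans lt_s _) => //.
    by rewrite lerDl sumr_ge0.
  by rewrite lerDl.
have [B B0 pB] := p k%:R (ler0n _ _).
have [d d0 dB] : exists2 d : R, 0 < d & 2 * k.+1%:R * B * d <= 1.
  have q0 : 0 < 2 * k.+1%:R * B + 1 by rewrite ltr_wpDl // !mulr_ge0.
  by exists (2 * k.+1%:R * B + 1)^-1; rewrite ?invr_gt0 // ler_pdivrMr // mul1r; lra.
pose cell (z : {ffun I -> int}) :=
  [set x : I -> R | forall i, d * (z i)%:~R <= x i < d * (z i)%:~R + d].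
apply: (@lebesgue_null_sub _ _ _ (\bigcup_z (E k `&` cell z))).
  move=> x Ex; exists [ffun i => Num.floor (x i / d)] => //; split=> // i.
  rewrite ffunE -ler_pdivlMl // -[X in _ + X]mulr1 -mulrDr -ltr_pdivrMl //.
  by rewrite mulrC floor_le /= -[1]/(1%:~R) -intrD floorD1_gt.
apply: (lebesgue_null_bigcup i0) => z.
apply: (@lebesgue_null_lipschitz_graph _ _ i0 k.+1%:R (2 * k.+1%:R * B)).
  move=> x i [[xk _ _] _]; have := xk i; rewrite ler_norml -natr1; lra.
move=> x y r r0 [[xk gx hx] xz] [[yk gy hy] yz] xy.
have [_ _ /(_ x r r0 xk xy)] := pB y yk.
rewrite gx gy subrr sub0r normrN normrM.
set D := x i0 - y i0 => le1.
have Dd : `|D| <= d by have := xz i0; have := yz i0; rewrite ler_norml /D; lra.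
have k0 : 0 < k.+1%:R :> R by [].
have le2 : `|D| <= k.+1%:R * (B * (D ^+ 2 + r)).
  rewrite -ler_pdivrMl //; apply: le_trans le1.
  by rewrite ler_wpM2r.
have le3 : D ^+ 2 <= d * `|D| by rewrite -real_normK ?num_real // expr2 ler_wpM2r.
have kB0 : 0 <= k.+1%:R * B by rewrite mulr_ge0.
have : k.+1%:R * B * D ^+ 2 <= k.+1%:R * B * (d * `|D|) by rewrite ler_wpM2l.
have : 2 * k.+1%:R * B * d * `|D| <= 1 * `|D| by rewrite ler_wpM2r.
lra.
Qed.

End PartialDerivative.

(** Exponents are distinct only on the support of [c] so that the induction survives
    differentiation: truncated subtraction can merge two exponents, but then one of the coefficients
    has become 0. *)
Lemma lebesgue_null_zeros (R : realType) (I T : finType) (i0 : I)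
    (e : T -> I -> nat) (c : T -> R) :
  (forall t t', c t != 0 -> c t' != 0 -> e t =1 e t' -> t = t') ->
  (exists t, c t != 0) ->
  lebesgue_null [set x : I -> R | \sum_t c t * monomial (e t) x = 0].
Proof.
move=> einj c0.
have [n] : exists n, forall t, c t != 0 -> (\sum_i e t i <= n)%N.
  exists (\sum_t \sum_i e t i)%N => t _.
  by rewrite [leqRHS](bigD1 t) //= leq_addr.
(* When all exponents on the support vanish, injectivity leaves one term, a nonzero constant, which
   has no zeros. *)
have const_case (e' : T -> I -> nat) (c' : T -> R) :
    (forall t t', c' t != 0 -> c' t' != 0 -> e' t =1 e' t' -> t = t') ->
    (exists t, c' t != 0) -> (forall t i, c' t != 0 -> e' t i = 0%N) ->
    lebesgue_null [set x : I -> R | \sum_t c' t * monomial (e' t) x = 0].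
  move=> einj' [t0 ct0] e0.
  suff -> : [set x : I -> R | \sum_t c' t * monomial (e' t) x = 0] = set0.
    exact: lebesgue_null0.
  apply/seteqP; split=> // x /=; rewrite (bigD1 t0) //= big1 => [|t tt0].
    rewrite addr0 /monomial big1 ?mulr1 => [ct0'|i _].
      by rewrite ct0' eqxx in ct0.
    by rewrite e0.
  have [->|ct] := eqVneq (c' t) 0; first by rewrite mul0r.
  by rewrite (einj' t t0) ?eqxx // in tt0 => i; rewrite !e0.
elim: n e c einj c0 => [|n IH] e c einj c0 en.
  apply: const_case => // t i /en; rewrite leqn0 sum_nat_eq0 => /forallP /(_ i).
  by move=> /eqP.
have [e0|] := pselect (forall t i, c t != 0 -> e t i = 0%N); first exact: const_case.
move=> /existsNP[t /existsNP[i /not_implyP[ct /eqP]]]; rewrite -lt0n => eti.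
(* The variable [i] occurs in a term with nonzero coefficient, so the derivative along [i] is a
   nonzero polynomial of smaller degree. *)
have p := is_partial_sum c (fun t => is_partial_monomial i (e t)).
set h := (X in is_partial _ _ X) in p.
have hE x : h x =
    \sum_t (c t * (e t i)%:R) * monomial (fun j => e t j - (j == i))%N x.
  by apply: eq_bigr => t' _; rewrite mulrA.
apply: (@lebesgue_null_sub _ _ _
  ([set x | \sum_t c t * monomial (e t) x = 0 /\ h x != 0] `|`
   [set x | h x = 0])).
  by move=> x fx; have [hx|hx] := eqVneq (h x) 0; [right | left].
apply: lebesgue_null_setU => //; first exact: lebesgue_null_regular_zeros p.
under eq_set do rewrite hE.
have supp t' : c t' * (e t' i)%:R != 0 -> c t' != 0 /\ (0 < e t' i)%N.
  by rewrite mulf_eq0 negb_or pnatr_eq0 -lt0n => /andP.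
have eK t' j : (0 < e t' i)%N -> (e t' j - (j == i) + (j == i))%N = e t' j.
  by move=> eti'; rewrite subnK //; case: eqP => [->|].
apply: IH.
+ move=> t1 t2 /supp[c1 e1] /supp[c2 e2] e12; apply: einj => // j.
  by rewrite -(eK t1) // -[RHS]eK // e12.
+ by exists t; rewrite mulf_neq0 // pnatr_eq0 -lt0n.
+ move=> t1 /supp[c1 e1]; have := en t1 c1.
  rewrite (bigD1 i) //= [X in _ -> (X <= _)%N](bigD1 i) //= eqxx.
  rewrite [X in _ -> (_ + X <= _)%N](eq_bigr (e t1)); last first.
    by move=> j /negbTE ->; rewrite subn0.
  by move: e1; case: (e t1 i) => // k _; rewrite subn1 addSn ltnS.
Qed.

(** At real points the real and imaginary parts of the sum are real polynomials, and one of them has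
    a nonzero coefficient. *)
Lemma lebesgue_null_complex_zeros (R : realType) (I T : finType) (i0 : I)
    (e : T -> I -> nat) (c : T -> R[i]) :
  (forall t t', e t =1 e t' -> t = t') ->
  (exists t, c t != 0) ->
  lebesgue_null [set x : I -> R | \sum_t c t * monomial (e t) (fun i => (x i)%:C) = 0].
Proof.
move=> einj [t ct].
have monC x t' : (monomial (e t') x)%:C = monomial (e t') (fun i => (x i)%:C) :> R[i].
  by rewrite /monomial rmorph_prod; apply: eq_bigr => i _; rewrite rmorphXn.
have ReE x : complex.Re (\sum_t c t * monomial (e t) (fun i => (x i)%:C)) =
    \sum_t complex.Re (c t) * monomial (e t) x.
  rewrite (raddf_sum (@complex.Re R : {additive Rcomplex R -> R})).
  by apply: eq_bigr => t' _; rewrite -monC; case: (c t') => a b /=; rewrite mulr0 subr0.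
have ImE x : complex.Im (\sum_t c t * monomial (e t) (fun i => (x i)%:C)) =
    \sum_t complex.Im (c t) * monomial (e t) x.
  rewrite (raddf_sum (@complex.Im R : {additive Rcomplex R -> R})).
  by apply: eq_bigr => t' _; rewrite -monC; case: (c t') => a b /=; rewrite mulr0 add0r.
have [re0|re0] := eqVneq (complex.Re (c t)) 0.
  have im0 : complex.Im (c t) != 0.
    by apply: contraNneq ct => im0; rewrite eq_complex re0 im0 eqxx.
  apply: lebesgue_null_sub
    (lebesgue_null_zeros (e := e) (c := fun t => complex.Im (c t)) i0 _ _).
  - by move=> x /= /(congr1 (@complex.Im R)); rewrite ImE.
  - by move=> t1 t2 _ _; exact: einj.
  - by exists t.
apply: lebesgue_null_sub
  (lebesgue_null_zeros (e := e) (c := fun t => complex.Re (c t)) i0 _ _).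
- by move=> x /= /(congr1 (@complex.Re R)); rewrite ReE.
- by move=> t1 t2 _ _; exact: einj.
- by exists t.
Qed.

(** * Dimension count *)

(** The matrix of coefficients over [h] has more rows than columns, so a nonzero row vector
    annihilates it. *)
Lemma linear_dependence (F : fieldType) (X : Type) (T U : finType)
    (f : T -> X -> F) (h : U -> X -> F) :
  (forall t, exists c : U -> F, forall x, f t x = \sum_u c u * h u x) ->
  (#|U| < #|T|)%N ->
  exists2 c : T -> F, exists t, c t != 0 & forall x, \sum_t c t * f t x = 0.
Proof.
move=> /choice[C CE] UT.
pose A : 'M[F]_(#|T|, #|U|) := \matrix_(i, j) C (enum_val i) (enum_val j).
have /rowV0Pn[v /sub_kermxP vA v0] : kermx A != 0.
  rewrite kermx_eq0; apply/negP => /eqP rA.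
  by have := rank_leq_col A; rewrite rA leqNgt UT.
exists (fun t => v 0 (enum_rank t)).
  have /existsNP[i /eqP vi] : ~ forall i, v 0 i = 0.
    by move=> vz; case/eqP: v0; apply/rowP => i; rewrite vz mxE.
  by exists (enum_val i); rewrite enum_valK.
move=> x; under eq_bigr do rewrite CE mulr_sumr.
rewrite exchange_big /= big1 // => u _.
have /matrixP/(_ 0 (enum_rank u)) := vA; rewrite !mxE => vAu.
under eq_bigr do rewrite mulrA.
rewrite -mulr_suml (_ : \sum_t _ = 0) ?mul0r // -[RHS]vAu.
rewrite [RHS](reindex (@enum_rank T)) /=; last exact/onW_bij/enum_rank_bij.
by apply: eq_bigr => t _; rewrite mxE !enum_rankK.
Qed.

(** * Numbers of monomials and their growth *)

Section Counting.
Local Open Scope nat_scope.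

Lemma leq_expl m n e : m <= n -> m ^ e <= n ^ e.
Proof. by case: e => // e mn; rewrite leq_exp2r. Qed.

Lemma exp_shift_lt (B c k : nat) : exists2 t, 0 < t & B * (t + c) ^ k < B.+1 * t ^ k.
Proof.
(* Cleared of denominators, this is the bound of [(1 + c/t)^k] by [1 + M/t], with [M] independent of
   [t]. *)
have [M PM] : exists M, forall t, 0 < t -> t * (t + c) ^ k <= t ^ k * (t + M).
  elim: k => [|k [M IH]]; first by exists 0 => t _; rewrite !expn0; lia.
  exists (M + c + M * c) => t t0; have {}IH := IH t t0.
  rewrite !expnS; apply: (@leq_trans (t ^ k * (t + M) * (t + c))).
    by rewrite mulnCA [leqRHS]mulnC leq_mul2l IH orbT.
  by rewrite [t * _]mulnC -!mulnA leq_mul2l; apply/orP; right; nia.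
(* Any [t] above [B * M] satisfies [B * (t + M) < B.+1 * t]. *)
exists (B * M).+1 => //; have := PM (B * M).+1 isT.
set t := (B * M).+1; have t0 : 0 < t by [].
have Mt : B * (t + M) < B.+1 * t by rewrite /t; nia.
have k0 : 0 < t ^ k by rewrite expn_gt0.
move: ((t + c) ^ k) (t ^ k) k0 => X Y Y0 le.
have le1 : B * (t * X) <= B * (Y * (t + M)) by rewrite leq_mul2l le orbT.
have lt2 : Y * (B * (t + M)) < Y * (B.+1 * t) by rewrite ltn_pmul2l.
by rewrite -(ltn_pmul2l t0); lia.
Qed.

Definition simplex (J : finType) (a : nat) : finType :=
  {f : {ffun J -> 'I_a.+1} | \sum_j f j <= a}.

(** Stars and bars: enumerating [J] turns exponent vectors into the tuples counted by
    [card_partial_ord_partitions]. *)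
Lemma card_simplex (J : finType) a : #|{: simplex J a}| = 'C(#|J| + a, #|J|).
Proof.
rewrite card_sig -card_partial_ord_partitions.
pose g (f : {ffun J -> 'I_a.+1}) := [tuple f (enum_val i) | i < #|J|].
have g_inj : injective g.
  move=> f1 f2 eq12; apply/ffunP => j.
  have := congr1 (fun u => tnth u (enum_rank j)) eq12.
  by rewrite !tnth_mktuple enum_rankK.
have g_sum f : \sum_(i <- g f) (i : 'I_a.+1) = \sum_j f j.
  rewrite big_tuple [RHS](reindex (@enum_val J predT)) /=; last first.
    exact/onW_bij/enum_val_bij.
  by apply: eq_bigr => i _; rewrite tnth_mktuple.
rewrite -(card_imset _ g_inj); apply: eq_card => u; rewrite inE.
apply/imsetP/idP => [[f + ->]|u_le]; first by rewrite inE g_sum.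
have uE : u = g [ffun j => tnth u (enum_rank j)].
  by apply: eq_from_tnth => i; rewrite tnth_mktuple ffunE enum_valK.
by exists [ffun j => tnth u (enum_rank j)]; rewrite // inE -g_sum -uE.
Qed.

(** By [bin_ffact] the left side is a falling factorial, whose [m] factors lie between [n.+1] and
    [m + n]. This bound and the next one replace each factor by an extreme one. *)
Lemma bin_sum_le m n : 'C(m + n, m) * m`! <= (m + n) ^ m.
Proof.
rewrite bin_ffact; elim: m n => // m IH n.
rewrite ffactnS addSn /= expnS leq_mul2l /=; apply: leq_trans (IH n) _.
exact: leq_expl.
Qed.

Lemma bin_sum_ge m n : n.+1 ^ m <= 'C(m + n, m) * m`!.
Proof.
rewrite bin_ffact; elim: m => // m IH.
by rewrite ffactnS addSn /= expnS leq_mul // ltnS leq_addl.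
Qed.

(* C(2m+t, 2m) D ~ t^(2m) / (m!)^2 ~ C(m+t+D, m)^2 as t grows, so D.+1 in place
   of D wins for large t; r large against t then absorbs the factors in e. *)
Lemma bihomogeneous_count m e d (D := 'C(2 * m, m)) : exists r t, (0 < r) /\
  (r + t * d) ^ e * ('C(m + (t + D), m) * 'C(m + (t + D), m))
    < r ^ e * 'C(2 * m + t, 2 * m) * D.+1.
Proof.
have [t t0 lt_t] := exp_shift_lt D (m + D) (2 * m).
pose A := 'C(m + (t + D), m) * 'C(m + (t + D), m).
have ltA : A < D.+1 * 'C(2 * m + t, 2 * m).
  have f0 : 0 < (2 * m)`! by exact: fact_gt0.
  have Df : D * (m`! * m`!) = (2 * m)`!.
    rewrite -(@bin_fact (2 * m) m) ?mul2n -?addnn ?leq_addr //.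
    by rewrite /D mul2n -addnn addnK.
  rewrite -(ltn_pmul2r f0) -mulnA.
  apply: (@leq_trans (D.+1 * t.+1 ^ (2 * m))); last by rewrite leq_mul2l bin_sum_ge.
  apply: (@leq_trans (D.+1 * t ^ (2 * m))); last by rewrite leq_mul2l leq_expl.
  apply: leq_ltn_trans lt_t; rewrite -Df /A mulnCA leq_mul2l; apply/orP; right.
  rewrite mul2n -addnn expnD mulnACA (addnCA t).
  by rewrite leq_mul ?bin_sum_le.
(* By [ltA] the right-hand side has room for the factor [A.+1], which is what [exp_shift_lt]
   requires. *)
have [r r0 lt_r] := exp_shift_lt A (t * d) e.
exists r, t; split=> //; rewrite [ltnLHS]mulnC; apply: (leq_trans lt_r).
by rewrite mulnC -mulnA leq_mul2l [leqRHS]mulnC ltA orbT.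
Qed.

End Counting.

(** * Polynomial functions of bounded multidegree *)

Section Multidegree.
Variables (F : fieldType) (I K : finType).
Local Notation W := (I + K + K)%type.
Implicit Types (f g : (W -> F) -> F) (e : W -> nat).

(* The degree is bounded by d in each variable of I separately, but by a and b
   in total over each of the two blocks K. *)
Definition exponent_le (d a b : nat) e :=
  [/\ forall i, (e (inl (inl i)) <= d)%N, (\sum_k e (inl (inr k)) <= a)%N &
      (\sum_k e (inr k) <= b)%N].

(** A predicate on functions instead of formal polynomials: a derivation is one expansion into
    admissible monomials, possibly with repetitions. *)
Inductive multidegree_le (d a b : nat) : ((W -> F) -> F) -> Prop :=
| multidegree_le0 : multidegree_le d a b (fun=> 0)
| multidegree_leD c e f : exponent_le d a b e -> multidegree_le d a b f ->
    multidegree_le d a b (fun x => c * monomial e x + f x).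

Lemma multidegree_le_add d a b f g : multidegree_le d a b f ->
  multidegree_le d a b g -> multidegree_le d a b (fun x => f x + g x).
Proof.
move=> ff gg; elim: ff => [|c e f' ee _ IH]; first by under eq_fun do rewrite add0r.
by under eq_fun do rewrite -addrA; exact: multidegree_leD.
Qed.

Lemma multidegree_le_monomial d a b c e : exponent_le d a b e ->
  multidegree_le d a b (fun x => c * monomial e x).
Proof.
move=> ee; have := multidegree_leD c ee (multidegree_le0 d a b).
by congr multidegree_le; apply: funext => x; rewrite addr0.
Qed.

Lemma multidegree_le_mul d1 a1 b1 d2 a2 b2 f g :
  multidegree_le d1 a1 b1 f -> multidegree_le d2 a2 b2 g ->
  multidegree_le (d1 + d2) (a1 + a2) (b1 + b2) (fun x => f x * g x).
Proof.
move=> ff gg; elim: ff => [|c e f' [e1 e2 e3] _ IH].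
  by under eq_fun do rewrite mul0r; exact: multidegree_le0.
under eq_fun do rewrite mulrDl; apply: multidegree_le_add => // {IH}.
elim: gg => [|c' e' g' [e1' e2' e3'] _ IH].
  by under eq_fun do rewrite mulr0; exact: multidegree_le0.
under eq_fun do rewrite mulrDr; apply: multidegree_le_add => // {IH}.
have := @multidegree_le_monomial (d1 + d2) (a1 + a2) (b1 + b2) (c * c')
  (fun w => e w + e' w)%N.
rewrite (_ : (fun x => _ * monomial _ x) =
             (fun x => c * monomial e x * (c' * monomial e' x))); last first.
  apply: funext => x; rewrite mulrACA; congr (_ * _).
  by rewrite /monomial -big_split; apply: eq_bigr => i _; rewrite exprD.
by apply; split=> [i||]; rewrite ?big_split leq_add.
Qed.

Lemma multidegree_le_weaken d a b d' a' b' f : (d <= d')%N -> (a <= a')%N ->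
  (b <= b')%N -> multidegree_le d a b f -> multidegree_le d' a' b' f.
Proof.
move=> dd aa bb; elim=> [|c e f' [e1 e2 e3] _ IH]; first exact: multidegree_le0.
apply: multidegree_leD => //; split=> [i||].
- exact: leq_trans dd.
- exact: leq_trans aa.
- exact: leq_trans bb.
Qed.

Lemma multidegree_le_cst c : multidegree_le 0 0 0 (fun=> c).
Proof.
have := @multidegree_le_monomial 0 0 0 c (fun=> 0)%N.
rewrite (_ : (fun x => _) = (fun=> c)).
  by apply; split=> //; rewrite sum_nat_const muln0.
by apply: funext => x; rewrite /monomial big1 ?mulr1.
Qed.

Lemma multidegree_le_coord w : multidegree_le
  (if w is inl (inl _) then 1 else 0)%N (if w is inl (inr _) then 1 else 0)%N
  (if w is inr _ then 1 else 0)%N (fun x => x w).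
Proof.
set d := (X in multidegree_le X); set a := (X in multidegree_le _ X).
set b := (X in multidegree_le _ _ X).
have := @multidegree_le_monomial d a b 1 (fun w' => (w' == w))%N.
rewrite (_ : (fun x => _) = (fun x => x w)); last first.
  apply: funext => x; rewrite mul1r /monomial (bigD1 w) //= eqxx expr1 big1 ?mulr1 //.
  by move=> j /negbTE ->.
apply; rewrite /d /a /b {d a b}; split=> [i||].
- by case: w => [[j|k]|k] //; case: eqP.
- case: w => [[j|k]|k]; [by rewrite big1| |by rewrite big1].
  by rewrite (bigD1 k) //= eqxx big1 // => k' kk; apply/eqP;
  rewrite eqb0; apply: contra kk => /eqP[->].
- case: w => [[j|k]|k]; [by rewrite big1|by rewrite big1|].
  by rewrite (bigD1 k) //= eqxx big1 // => k' kk; apply/eqP;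
  rewrite eqb0; apply: contra kk => /eqP[->].
Qed.

Lemma multidegree_le_sum (T : finType) (P : pred T) d a b (f : T -> (W -> F) -> F) :
  (forall t, P t -> multidegree_le d a b (f t)) ->
  multidegree_le d a b (fun x => \sum_(t | P t) f t x).
Proof.
move=> ff; elim: (index_enum T) => [|t s IH].
  by under eq_fun do rewrite big_nil; exact: multidegree_le0.
have [Pt|nPt] := boolP (P t).
  by under eq_fun do rewrite big_cons Pt; apply: multidegree_le_add => //; exact: ff.
by under eq_fun do rewrite big_cons (negbTE nPt).
Qed.

Lemma multidegree_le_exp d a b f n : multidegree_le d a b f ->
  multidegree_le (n * d) (n * a) (n * b) (fun x => f x ^+ n).
Proof.
move=> ff; elim: n => [|n IH]; first exact: multidegree_le_cst.
by under eq_fun do rewrite exprS; rewrite !mulSn; exact: multidegree_le_mul.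
Qed.

Lemma multidegree_le_prod (T : finType) (d a b : T -> nat) (f : T -> (W -> F) -> F) :
  (forall t, multidegree_le (d t) (a t) (b t) (f t)) ->
  multidegree_le (\sum_t d t) (\sum_t a t) (\sum_t b t) (fun x => \prod_t f t x).
Proof.
move=> ff; elim: (index_enum T) => [|t s IH].
  have := multidegree_le_cst 1; rewrite !big_nil.
  by congr multidegree_le; apply: funext => x; rewrite big_nil.
have := multidegree_le_mul (ff t) IH; rewrite !big_cons.
by congr multidegree_le; apply: funext => x; rewrite big_cons.
Qed.

Definition exponents (d a b : nat) : finType :=
  ({ffun I -> 'I_d.+1} * simplex K a * simplex K b)%type.

Definition exponent_of d a b (t : exponents d a b) : W -> nat :=
  fun w => match w with
  | inl (inl i) => t.1.1 i
  | inl (inr k) => val t.1.2 k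
  | inr k => val t.2 k
  end.

Lemma card_exponents d a b : #|{: exponents d a b}| =
  (d.+1 ^ #|I| * ('C(#|K| + a, #|K|) * 'C(#|K| + b, #|K|)))%N.
Proof. by rewrite !card_prod card_ffun card_ord !card_simplex mulnA. Qed.

Lemma exponent_leP d a b e : exponent_le d a b e ->
  exists t : exponents d a b, exponent_of t =1 e.
Proof.
move=> [e1 e2 e3].
have simp (n : nat) (u : K -> nat) : (\sum_k u k <= n)%N ->
    exists s : simplex K n, forall k, val s k = u k :> nat.
  move=> un; have ltu k : (u k < n.+1)%N.
    by rewrite ltnS (leq_trans _ un) // (bigD1 k) //= leq_addr.
  have sP : (\sum_k [ffun k => Ordinal (ltu k)] k <= n)%N.
    by under eq_bigr do rewrite ffunE.
  exists (exist (fun f : {ffun K -> 'I_n.+1} => \sum_k f k <= n)%N _ sP) => k.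
  by rewrite /= ffunE.
have [s1 s1P] := simp _ _ e2; have [s2 s2P] := simp _ _ e3.
exists ([ffun i => Ordinal (e1 i : (_ < d.+1)%N)], s1, s2) => -[[i|k]|k] //=.
by rewrite ffunE.
Qed.

Lemma multidegree_le_span d a b f : multidegree_le d a b f ->
  exists c : exponents d a b -> F,
    forall x, f x = \sum_t c t * monomial (exponent_of t) x.
Proof.
elim=> [|c e f' /exponent_leP[t0 t0e] _ [c' c'E]].
  by exists (fun=> 0) => x; rewrite big1 // => t _; rewrite mul0r.
exists (fun t => (if t == t0 then c else 0) + c' t) => x.
under eq_bigr do rewrite mulrDl.
rewrite big_split -c'E /= (bigD1 t0) //= eqxx big1 => [|t /negbTE ->];
  last by rewrite mul0r.
by rewrite addr0; congr (_ * _ + _); apply: eq_bigr => i _; rewrite t0e.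
Qed.

End Multidegree.

(** * The relation between a linear form and the components of a map *)

Section EliminationRelation.
Variables (F : fieldType) (I K : finType).
Local Notation W := (I + K + K)%type.

Definition substitute (G : K + K -> (W -> F) -> F) (x : W -> F) : W -> F :=
  fun w => match w with
  | inl (inl i) => x (inl (inl i))
  | inl (inr k) => G (inl k) x
  | inr k => G (inr k) x
  end.

Lemma elimination_relation (G : K + K -> (W -> F) -> F) (g : (W -> F) -> F) (d : nat)
    (D := 'C(2 * #|K|, #|K|)) :
  (forall s, multidegree_le d 1 1 (G s)) -> multidegree_le 0 1 1 g ->
  exists (T : finType) (e : T -> W -> nat) (c : T * 'I_D.+1 -> F),
    [/\ forall t t', e t =1 e t' -> t = t', exists t, c t != 0 &
      forall x, \sum_t c t * (monomial (e t.1) (substitute G x) * g x ^+ t.2) = 0].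
Proof.
move=> GG gg; have [r [t [r0 lt_rt]]] := bihomogeneous_count #|K| #|I| d.
pose T : finType := ({ffun I -> 'I_r} * simplex (K + K) t)%type.
pose e (p : T) (w : W) : nat := match w with
  | inl (inl i) => p.1 i
  | inl (inr k) => val p.2 (inl k)
  | inr k => val p.2 (inr k)
  end.
have monE p x : monomial (e p) (substitute G x) =
    (\prod_i x (inl (inl i)) ^+ p.1 i) * \prod_s G s x ^+ val p.2 s.
  by rewrite /monomial !big_sumType /= -mulrA.
exists T, e.
suff [c c0 cE] : exists2 c : T * 'I_D.+1 -> F, exists t, c t != 0 &
    forall x, \sum_t c t * (monomial (e t.1) (substitute G x) * g x ^+ t.2) = 0.
  exists c; split=> // -[b1 s1] [b2 s2] eq12; congr (_, _).
    by apply/ffunP => i; apply: val_inj; exact: (eq12 (inl (inl i))).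
  apply: val_inj; apply/ffunP => -[k|k]; apply: val_inj.
    exact: (eq12 (inl (inr k))).
  exact: (eq12 (inr k)).
(* In each variable of [I] the factor indexed by [b] has degree at most [r.-1], the powers of [G] at
   most [t * d], and [g] has degree 0. This leaves [r + t * d] exponents per variable, the base in
   [bihomogeneous_count]. *)
apply: (@linear_dependence F (W -> F) (T * 'I_D.+1)%type
  (exponents I K (r + t * d).-1 (t + D) (t + D))
  (fun t x => monomial (e t.1) (substitute G x) * g x ^+ t.2)
  (fun u x => monomial (exponent_of u) x)).
- move=> [[b s] j]; apply: multidegree_le_span.
  have beta_le : multidegree_le r.-1 0 0
      (fun x : W -> F => \prod_i x (inl (inl i)) ^+ (b : {ffun I -> 'I_r}) i).
    pose eb (w : W) : nat := if w is inl (inl i) then b i else 0%N.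
    have := @multidegree_le_monomial F I K r.-1 0 0 1 eb.
    rewrite (_ : (fun x => _) =
      (fun x : W -> F => \prod_i x (inl (inl i)) ^+ (b : {ffun I -> 'I_r}) i)).
      apply; split=> [i||]; rewrite ?big1 //=.
      by rewrite -ltnS prednK.
    apply: funext => x; rewrite mul1r /monomial !big_sumType /=.
    by rewrite [X in _ * X * _]big1 // [X in _ * X]big1 // !mulr1.
  have alpha_le := multidegree_le_prod
    (fun s' => multidegree_le_exp (val s s') (GG s')).
  have := multidegree_le_mul (multidegree_le_mul beta_le alpha_le)
    (multidegree_le_exp j gg).
  have st : (\sum_s' sval s s' <= t)%N := valP s.
  have jD : (j <= D)%N by rewrite -ltnS.
  rewrite (_ : (fun x => _) =
    (fun x => monomial (e (b, s)) (substitute G x) * g x ^+ j)); last first.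
    by apply: funext => x; rewrite monE.
  rewrite -!big_distrl /= !muln1.
  have std : ((\sum_s' sval s s') * d <= t * d)%N by rewrite leq_mul2r st orbT.
  move: (\sum_s' _)%N st std => S st std.
  by apply: multidegree_le_weaken; lia.
- rewrite card_exponents !card_prod card_ffun !card_ord card_simplex card_sum.
  by rewrite prednK ?addn_gt0 ?r0 // addnn -mul2n.
Qed.
End EliminationRelation.

(** * Counting solutions *)

Lemma poly_nat_nonroot (F : numDomainType) (p : {poly F}) :
  p != 0 -> exists n : nat, ~~ root p n%:R.
Proof.
move=> p0; apply: contrapT => /forallNP rp.
pose s : seq F := [seq n%:R | n <- iota 0 (size p)].
have roots : all (root p) s.
  by apply/allP => _ /mapP[n _ ->]; have /negP := rp n; rewrite negbK.
have us : uniq s.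
  by rewrite map_inj_uniq ?iota_uniq // => m n /eqP; rewrite eqr_nat => /eqP.
by have := max_poly_roots p0 roots us; rewrite size_map size_iota ltnn.
Qed.

(** The weights of two distinct points differ by the value at [n] of a nonzero polynomial, and some
    natural number is no root of the product over all pairs. Natural parameters keep the family of
    linear forms countable. *)
Lemma separating_power_weight (F : numFieldType) (T : eqType) (J : finType)
    (f : T -> J -> F) (s : seq T) :
  {in s &, forall a b, f a =1 f b -> a = b} ->
  exists n : nat, {in s &, injective (fun a => \sum_j n%:R ^+ enum_rank j * f a j)}.
Proof.
move=> finj.
pose p a b := \sum_j (f a j - f b j) *: 'X^(enum_rank j) : {poly F}.
have pE a b n : (p a b).[n%:R] = \sum_j n%:R ^+ enum_rank j * f a j
                               - \sum_j n%:R ^+ enum_rank j * f b j.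
  rewrite horner_sum -sumrB; apply: eq_bigr => j _.
  by rewrite hornerZ hornerXn -mulrBr mulrC.
have p0 a b : a \in s -> b \in s -> a != b -> p a b != 0.
  move=> sa sb; apply: contra => /eqP pab; apply/eqP/finj => // j.
  have /(congr1 (fun q : {poly F} => q`_(enum_rank j))) := pab.
  rewrite coef0 coef_sum (bigD1 j) //= coefZ coefXn eqxx mulr1 big1 ?addr0.
    by move/eqP; rewrite subr_eq0 => /eqP.
  move=> i ij; rewrite coefZ coefXn (_ : (_ == _ :> nat) = false) ?mulr0 //.
  by apply: contraNF ij => /eqP/val_inj/enum_rank_inj ->.
pose q := \prod_(a <- s) \prod_(b <- s | a != b) p a b.
have q0 : q != 0.
  rewrite prodf_seq_neq0; apply/allP => a sa /=; rewrite prodf_seq_neq0.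
  by apply/allP => b sb; apply/implyP; exact: p0.
have [n nq] := poly_nat_nonroot q0; exists n => a b sa sb eqab.
apply/eqP; apply: contraNT nq => ab.
rewrite /q /root horner_prod; apply/eqP; rewrite (big_rem a) //= horner_prod.
by rewrite [X in X * _](big_rem b) //= ab pE eqab subrr !mul0r.
Qed.

(** A duplicate-free sequence in [S] of maximal length exhausts [S], since any further point would
    lengthen it. *)
Lemma card_le_of_seqs (T : choiceType) (S : set T) (D : nat) :
  (forall s : seq T, uniq s -> (forall x, x \in s -> S x) -> (size s <= D)%N) ->
  finite_set S /\ (S #<= `I_D)%card.
Proof.
move=> bnd.
pose Q n := `[< exists s : seq T, [/\ uniq s, forall x, x \in s -> S x & size s = n] >].
have exQ : exists n, Q n by exists 0%N; apply/asboolP; exists [::].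
have bQ n : Q n -> (n <= D)%N by move/asboolP => [s [us sS <-]]; exact: bnd.
case: (ex_maxnP exQ bQ) => n /asboolP[s [us sS sn]] nmax.
have SE : S = [set` [fset x in s]%fset].
  apply/seteqP; split=> x /=; rewrite inE; last exact: sS.
  move=> Sx; apply: contraT => xs; suff : (n.+1 <= n)%N by rewrite ltnn.
  apply: nmax; apply/asboolP; exists (x :: s); split; rewrite /= ?xs ?sn //.
  by move=> y; rewrite inE => /predU1P[->//|]; exact: sS.
have cS : (S #= `I_n)%card.
  by rewrite SE; apply/card_eq_fsetP; rewrite card_fseq undup_id.
split; first by apply/finite_setP; exists n.
rewrite (card_le_eql cS) card_le_II; apply: bQ; apply/asboolP.
by exists s.
Qed.

(** * The power flow equations as a polynomial map *)

Section PowerFlowMap.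
Variables (R : realType) (N : finType) (E : rel N) (ref : N).
Local Notation C := R[i].
Local Notation K := {k : N | k != ref}.
Local Notation I0 := ({kl : N * N | (kl.1 == kl.2) || E kl.1 kl.2} * bool + unit)%type.
Local Notation W := (I0 + K + K)%type.
Implicit Types (x : W -> C) (P : parameters R E ref).
Implicit Types (vu : {ffun N -> C} * {ffun N -> C}).

(* In a point of C^W, the slots of the p_k and q_k hold the unknowns v_k and u_k.
   With c = 'i the entry is Y_(k, l); with c = -'i it is the polynomial expression
   of the conjugate of Y_(k, l) in its real and imaginary parts. *)
Definition admittance_entry (c : C) x (k l : N) : C :=
  if insub (k, l) is Some kl then
    x (inl (inl (inl (kl, true)))) + c * x (inl (inl (inl (kl, false))))
  else 0.

Definition v_entry x (l : N) : C :=
  if insub l is Some k then x (inl (inr k)) else x (inl (inl (inr tt))).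

Definition u_entry x (l : N) : C :=
  if insub l is Some k then x (inr k) else x (inl (inl (inr tt))).

(** At a solution and a non-reference bus this is [p_k + i q_k], and [conj_power_term] is
    [p_k - i q_k]. *)
Definition power_term (x : W -> C) (k : N) : C :=
  v_entry x k * (\sum_l admittance_entry 'i x k l * u_entry x l).

Definition conj_power_term (x : W -> C) (k : N) : C :=
  u_entry x k * (\sum_l admittance_entry (- 'i) x k l * v_entry x l).

Definition power_map (s : K + K) (x : W -> C) : C :=
  match s with
  | inl k => 2^-1 * (power_term x (val k) + conj_power_term x (val k))
  | inr k => (2 * 'i)^-1 * (power_term x (val k) - conj_power_term x (val k))
  end.

Definition unknown (s : K + K) x : C :=
  match s with inl k => x (inl (inr k)) | inr k => x (inr k) end.

Definition point_of P vu : W -> C := fun w =>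
  match w with
  | inl (inl i) => (@coordinates R N E ref P (inl (inl i)))%:C
  | inl (inr k) => vu.1 (val k)
  | inr k => vu.2 (val k)
  end.

Lemma multidegree_le_admittance_entry c k l :
  multidegree_le 1 0 0 (fun x => admittance_entry c x k l).
Proof.
rewrite /admittance_entry; case: insubP => [kl _ _|_]; last first.
  exact: multidegree_le0.
apply: multidegree_le_add.
  exact: (multidegree_le_coord _ (inl (inl (inl (kl, true))))).
apply: (@multidegree_le_mul C I0 K 0 0 0 1 0 0); first exact: multidegree_le_cst.
exact: (multidegree_le_coord _ (inl (inl (inl (kl, false))))).
Qed.

Lemma multidegree_le_v_entry l : multidegree_le 1 1 0 (fun x => v_entry x l).
Proof.
rewrite /v_entry; case: insubP => [k _ _|_].
  by apply: multidegree_le_weaken (multidegree_le_coord _ (inl (inr k))).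
by apply: multidegree_le_weaken (multidegree_le_coord _ (inl (inl (inr tt)))).
Qed.

Lemma multidegree_le_u_entry l : multidegree_le 1 0 1 (fun x => u_entry x l).
Proof.
rewrite /u_entry; case: insubP => [k _ _|_].
  by apply: multidegree_le_weaken (multidegree_le_coord _ (inr k)).
by apply: multidegree_le_weaken (multidegree_le_coord _ (inl (inl (inr tt)))).
Qed.

(** The degree 3 in the circuit parameters comes from an admittance and two voltages: at the
    reference bus a voltage is itself the parameter [|v_0|]. *)
Lemma multidegree_le_power_map s : multidegree_le 3 1 1 (power_map s).
Proof.
have power k : multidegree_le 3 1 1 (fun x => power_term x k).
  apply: (multidegree_le_mul (multidegree_le_v_entry k)).
  apply: (@multidegree_le_sum C I0 K N xpredT 2 0 1) => l _.
  exact: multidegree_le_mul (multidegree_le_admittance_entry _ k l)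
    (multidegree_le_u_entry l).
have conj_power k : multidegree_le 3 1 1 (fun x => conj_power_term x k).
  apply: (multidegree_le_mul (multidegree_le_u_entry k)).
  apply: (@multidegree_le_sum C I0 K N xpredT 2 1 0) => l _.
  exact: multidegree_le_mul (multidegree_le_admittance_entry _ k l)
    (multidegree_le_v_entry l).
have scale c f : multidegree_le 3 1 1 f ->
    multidegree_le 3 1 1 (fun x : W -> C => c * f x).
  exact: (multidegree_le_mul (multidegree_le_cst _ _ c)).
case: s => k; apply/scale; apply: multidegree_le_add => //.
have := scale (-1) _ (conj_power (val k)).
by congr multidegree_le; apply: funext => x; rewrite mulN1r.
Qed.

(** [W] is also the index type of the parameter coordinates. Hence at a solution the coefficients of
    an elimination relation depend on [P] alone. *)
Lemma power_map_point_of P vu : power_flow_solutions P vu ->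
  substitute power_map (point_of P vu) =1 fun w => (coordinates P w)%:C.
Proof.
case: vu => v u [/= p_eq q_eq vr ur].
pose x := point_of P (v, u).
have vE l : v_entry x l = v l.
  rewrite /v_entry; case: insubP => [k _ <- //|]; rewrite negbK => /eqP ->.
  by rewrite vr.
have uE l : u_entry x l = u l.
  rewrite /u_entry; case: insubP => [k _ <- //|]; rewrite negbK => /eqP ->.
  by rewrite ur.
have YE k l : admittance_entry 'i x k l = admittance P k l.
  rewrite /admittance_entry; case: insubP => [kl _ e|].
    by rewrite [RHS]complexE /= e.
  by rewrite negb_or => /andP[kl Ekl]; rewrite admittance_sparse.
have YcE k l : admittance_entry (- 'i) x k l = (admittance P k l)^*%C.
  rewrite /admittance_entry; case: insubP => [kl _ e|].
    rewrite /= e /=; case: (admittance P k l) => a b /=.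
    apply/eqP; rewrite eq_complex /=.
    by rewrite !(mulr0, mul0r, addr0, add0r, subr0, oppr0, mulN1r) !eqxx.
  by rewrite negb_or => /andP[kl Ekl]; rewrite admittance_sparse //= oppr0.
have sE k : power_term x k = v k * (\sum_l admittance P k l * u l).
  by rewrite /power_term vE; congr (_ * _); apply: eq_bigr => l _; rewrite YE uE.
have scE k : conj_power_term x k = u k * (\sum_l (admittance P k l)^*%C * v l).
  by rewrite /conj_power_term uE; congr (_ * _); apply: eq_bigr => l _; rewrite YcE vE.
have two0 : 2 != 0 :> C by rewrite pnatr_eq0.
have i0 : 'i != 0 :> C by rewrite eq_complex /= oner_eq0 andbF.
move=> [[i|k]|k] //=; rewrite -/x sE scE.
- by rewrite p_eq mulKf.
- by rewrite q_eq mulKf // mulf_neq0.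
Qed.

Definition unknowns_weight (n : nat) x : C :=
  \sum_s n%:R ^+ enum_rank s * unknown s x.

Lemma multidegree_le_unknowns_weight n : multidegree_le 0 1 1 (unknowns_weight n).
Proof.
apply: (@multidegree_le_sum C I0 K (K + K)%type xpredT) => s _.
apply: (@multidegree_le_mul C I0 K 0 0 0 0 1 1); first exact: multidegree_le_cst.
case: s => k /=.
  by apply: multidegree_le_weaken (multidegree_le_coord _ (inl (inr k))).
by apply: multidegree_le_weaken (multidegree_le_coord _ (inr k)).
Qed.

Lemma generic_weight_bound (n : nat) : exists Z : set (W -> R),
  lebesgue_null Z /\
  forall P, ~ Z (coordinates P) ->
  forall s : seq ({ffun N -> C} * {ffun N -> C}), uniq s ->
    (forall vu, vu \in s -> power_flow_solutions P vu) ->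
    {in s &, injective (fun vu => unknowns_weight n (point_of P vu))} ->
    (size s <= 'C(2 * #|{: K}|, #|{: K}|))%N.
Proof.
set D := 'C(_, _).
have [T [e [c [einj [[t0 j0] ct0] rel]]]] :=
  elimination_relation multidegree_le_power_map (multidegree_le_unknowns_weight n).
pose A j (z : W -> R) : C := \sum_t c (t, j) * monomial (e t) (fun w => (z w)%:C).
exists [set z | A j0 z = 0]; split.
  (* The index supplied is the coordinate of [|v_0|], present for every graph. *)
  apply: (lebesgue_null_complex_zeros (inl (inl (inr tt))) einj
    (c := fun t => c (t, j0))).
  by exists t0.
move=> P /= Aj0 s us sol inj.
(* Nonzero because of its coefficient at [j0], and of degree at most [D]; the weights of all
   solutions are among its roots. *)
pose q : {poly C} := \poly_(j < D.+1) A (inord j) (coordinates P).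
have q0 : q != 0.
  apply/eqP => /(congr1 (fun r : {poly C} => r`_j0)).
  by rewrite coef0 coef_poly ltn_ord inord_val.
have roots : all (root q) [seq unknowns_weight n (point_of P vu) | vu <- s].
  apply/allP => _ /mapP[vu vus ->]; apply/eqP; rewrite /q horner_poly.
  rewrite -[RHS](rel (point_of P vu)).
  rewrite (eq_bigr (fun j => \sum_t c (t, j) * (monomial (e t)
    (substitute power_map (point_of P vu)) *
    unknowns_weight n (point_of P vu) ^+ j))); last first.
    move=> j _; rewrite inord_val mulr_suml; apply: eq_bigr => t _.
    rewrite mulrA; congr (_ * _ * _); apply: eq_bigr => w _.
    by rewrite power_map_point_of //; exact: sol.
  by rewrite exchange_big pair_bigA; apply: eq_bigr => -[t j].
have uroots : uniq [seq unknowns_weight n (point_of P vu) | vu <- s].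
  by rewrite map_inj_in_uniq.
have := leq_trans (max_poly_roots q0 roots uroots) (size_poly _ _).
by rewrite size_map ltnS.
Qed.

End PowerFlowMap.

Local Close Scope complex_scope.
Local Close Scope ring_scope.
Unset Implicit Arguments.

Theorem theorem1 (R : realType) (N : finType) (E : rel N) (ref : N)
    (Esym : symmetric E) :
  exists Z : set (parameters R E ref),
    parameters_null Z /\
    forall P : parameters R E ref, ~ Z P ->
      finite_set (power_flow_solutions P) /\
      (power_flow_solutions P #<= `I_'C(2 * #|N| - 2, #|N| - 1))%card.
Proof.
have /choice[Z ZP] := @generic_weight_bound R N E ref.
(* The separating [n] depends on the solutions and so on [P]; therefore the exceptional sets of all
   [n] are excluded at once. *)
exists [set P | exists n, Z n (coordinates P)]; split.
  apply: (@lebesgue_null_sub _ _ _ (\bigcup_n Z n)).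
    by move=> _ [P [n ZnP] <-]; exists n.
  by apply: lebesgue_null_bigcup_nat => n; case: (ZP n).
move=> P /= nZ; apply: card_le_of_seqs => s us sol.
have cardK : #|{: {k : N | k != ref}}| = (#|N| - 1)%N.
  by rewrite card_sig subn1 -(cardC1 ref).
pose unk (vu : {ffun N -> R[i]} * {ffun N -> R[i]}) t := unknown t (point_of P vu).
(* The reference entries of [v] and [u] are fixed by the equations, so the unknowns determine a
   solution. *)
have unk_inj : {in s &, forall a b, unk a =1 unk b -> a = b}.
  move=> [v u] [v' u'] /sol[/= _ _ vr ur] /sol[/= _ _ vr' ur'] eq_unk.
  congr (_, _); apply/ffunP => l; have [->|lr] := eqVneq l ref.
  - by rewrite vr vr'.
  - exact: (eq_unk (inl (Sub l lr))).
  - by rewrite ur ur'.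
  - exact: (eq_unk (inr (Sub l lr))).
have [n ninj] := separating_power_weight unk_inj.
case: (ZP n) => _ /(_ P) bnd.
rewrite -cardK (_ : 2 * #|N| - 2 = 2 * #|{: {k : N | k != ref}}|)%N; last first.
  by rewrite cardK mulnBr muln1.
by apply: bnd => // ZnP; apply: nZ; exists n.
Qed.
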